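(* Let $\lambda$ be Lebesgue measure on $\mathbf R$ and $L^1_{++}((0,\infty),\lambda)=\{f\in L^1((0,\infty),\lambda): f>0\ \lambda\text{-a.e.}\}$ with the $L^1$-norm topology. Let $\mathbf F=\{f\in C((0,\infty),(0,\infty)) : \lim_{x\to 0}f(x)=\lim_{x\to\infty}f(x)=1\}$, and set $(f\cdot g)(x)=f(x)g(x)$ for $f\in\mathbf F$, $g\in L^1_{++}((0,\infty),\lambda)$, $x\in(0,\infty)$. Then: (i) $\mathbf F$ is a commutative Polish group under pointwise multiplication; (ii) $\mathbf F\times L^1_{++}((0,\infty),\lambda)\ni(f,g)\mapsto f\cdot g\in L^1_{++}((0,\infty),\lambda)$ is a continuous Polish group action.
   Context: $\mathbf F$ is topologized by the metric $\rho(f,g)=\sup_{x>0} d(f(x),g(x))$, where $d(x,y)=|x-y|+|1/x-1/y|$ on $(0,\infty)$. *)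

(* Defs.v *)
From HB Require Import structures.
From mathcomp Require Import all_boot all_order all_algebra.
From mathcomp Require Import all_classical all_reals all_analysis.
From mathcomp Require Import measurable_realfun.
From mathcomp Require Import lra.
Set Implicit Arguments.
Unset Strict Implicit.
Unset Printing Implicit Defensive.
Import Order.TTheory GRing.Theory Num.Theory.
Import numFieldNormedType.Exports.
Local Open Scope classical_set_scope.
Local Open Scope ring_scope.

Section polish.
Variable R : realType.

Definition is_metric (T : Type) (d : T -> T -> R) : Prop :=
  [/\ forall x y, d x y = 0 <-> x = y,
      forall x y, d x y = d y x &
      forall x y z, d x z <= d x y + d y z].

Definition metrizes (T : topologicalType) (d : T -> T -> R) : Prop :=
  forall x : T, nbhs x = nbhs_ball_ (fun y e => [set z | d y z < e]) x.

Definition metric_complete (T : topologicalType) (d : T -> T -> R) : Prop :=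
  forall u : nat -> T,
    (forall e, 0 < e -> exists N : nat, forall m n : nat,
        (N <= m)%N -> (N <= n)%N -> d (u m) (u n) < e) ->
    exists l : T, u @ \oo --> l.

Definition completely_metrizable (T : topologicalType) : Prop :=
  exists d : T -> T -> R, [/\ is_metric d, metrizes d & metric_complete d].

Definition separable_space (T : topologicalType) : Prop :=
  exists2 D : set T, countable D & dense D.

Definition polish_space (T : topologicalType) : Prop :=
  separable_space T /\ completely_metrizable T.

End polish.

HB.structure Definition PreTopologicalGroup := {G of Topological G & Group G}.

Definition topological_group (G : PreTopologicalGroup.type) : Prop :=
  continuous (fun p : G * G => (p.1 * p.2)%g) /\
  continuous (fun x : G => x^-1%g).

Definition polish_group (R : realType) (G : PreTopologicalGroup.type) : Prop :=
  topological_group G /\ polish_space R G.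

Definition group_action (G : groupType) (X : Type) (a : G -> X -> X) : Prop :=
  (forall x, a 1%g x = x) /\ (forall g h x, a (g * h)%g x = a g (a h x)).

Definition continuous_polish_group_action (R : realType)
    (G : PreTopologicalGroup.type) (X : topologicalType) (a : G -> X -> X) :=
  [/\ polish_group R G, polish_space R X, group_action a &
      continuous (fun p : G * X => a p.1 p.2)].

Section positive_reals.
Variable R : realType.

Definition posreals : set R := [set x | 0 < x].

Lemma measurable_posreals : measurable posreals.
Proof.
rewrite (_ : posreals = `]0, +oo[%classic); first exact: measurable_itv.
by apply/seteqP; split=> x /=; rewrite in_itv/= andbT.
Qed.

Lemma posreals_gt0 (x : posreals) : 0 < set_val x.
Proof. exact: (set_mem (valP x)). Qed.

Definition dpos (x y : R) : R := `|x - y| + `|x^-1 - y^-1|.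

Lemma dposxx x : dpos x x = 0.
Proof. by rewrite /dpos !subrr normr0 addr0. Qed.

Lemma dpos_ge0 x y : 0 <= dpos x y.
Proof. by rewrite addr_ge0. Qed.

Lemma dpos_sym x y : dpos x y = dpos y x.
Proof. by rewrite /dpos distrC (distrC x^-1). Qed.

Lemma dpos_triangle y x z : dpos x z <= dpos x y + dpos y z.
Proof.
rewrite /dpos addrACA lerD//.
  by rewrite (le_trans _ (ler_normD _ _))// addrA subrK.
by rewrite (le_trans _ (ler_normD _ _))// addrA subrK.
Qed.

Lemma dpos_le0 x y : dpos x y <= 0 -> x = y.
Proof.
rewrite /dpos => h; apply/eqP; rewrite -subr_eq0 -normr_le0.
by apply: le_trans h; rewrite lerDl.
Qed.

End positive_reals.
Arguments posreals : clear implicits.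

Section Fspace_def.
Variable R : realType.

(* 'valL_1 f extends f to R by the value 1 on (-oo,0]; both limits below only
   see the values of f on (0,oo). *)
Definition Fspec (f : posreals R -> R) : Prop :=
  [/\ continuous f, forall x, 0 < f x,
      'valL_1 f x @[x --> 0^'+] --> (1 : R) &
      'valL_1 f x @[x --> +oo] --> (1 : R)].

Record Fspace := MkFspace { Ffun :> posreals R -> R ; FspaceP : Fspec Ffun }.

Lemma Fspace_eq (f g : Fspace) : f =1 g -> f = g.
Proof.
case: f g => f Pf [g Pg] /= /funext fg; case: _ / fg in Pg *.
by rewrite (Prop_irrelevance Pf Pg).
Qed.

HB.instance Definition _ := gen_eqMixin Fspace.
HB.instance Definition _ := gen_choiceMixin Fspace.

Lemma valL_pos (f : posreals R -> R) v (x : posreals R) :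
  valL_ v f (set_val x) = f x.
Proof. by have /(congr1 (fun h => h x)) := valLK v f. Qed.

Lemma valL_out (f : posreals R -> R) v (x : R) : x <= 0 -> valL_ v f x = v.
Proof.
move=> x0; rewrite /valL_ /= oinv_set_val insubF//.
by apply/negP => /set_mem/=; rewrite /posreals/= ltNge x0.
Qed.

Lemma posrealsE (x : R) : 0 < x -> exists y : posreals R, x = set_val y.
Proof. by move=> x0; exists (exist _ x (mem_set x0)). Qed.

Lemma Fspec_mul (f g : Fspace) : Fspec (fun x => f x * g x).
Proof.
case: f g => f [cf f0 fl fr] [g [cg g0 gl gr]] /=.
have E x : 'valL_1 (fun x => f x * g x) x = 'valL_1 f x * 'valL_1 g x.
  have [x0|x0] := leP x 0; first by rewrite !valL_out// mulr1.
  by have [y ->] := posrealsE x0; rewrite !valL_pos.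
split.
- by move=> x; exact: (cvgM (cf x) (cg x)).
- by move=> x; rewrite mulr_gt0.
- by under eq_cvg do rewrite E; have := cvgM fl gl; rewrite mulr1; exact.
- by under eq_cvg do rewrite E; have := cvgM fr gr; rewrite mulr1; exact.
Qed.

Lemma Fspec_inv (f : Fspace) : Fspec (fun x => (f x)^-1).
Proof.
case: f => f [cf f0 fl fr] /=.
have E x : 'valL_1 (fun x => (f x)^-1) x = ('valL_1 f x)^-1.
  have [x0|x0] := leP x 0; first by rewrite !valL_out// invr1.
  by have [y ->] := posrealsE x0; rewrite !valL_pos.
split.
- by move=> x; apply: (cvgV _ (cf x)); rewrite gt_eqF.
- by move=> x; rewrite invr_gt0.
- under eq_cvg do rewrite E.
  by have := cvgV (oner_neq0 R) fl; rewrite invr1; exact.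
- under eq_cvg do rewrite E.
  by have := cvgV (oner_neq0 R) fr; rewrite invr1; exact.
Qed.

Lemma Fspec_one : Fspec (fun=> 1).
Proof.
have E (x : R) : 'valL_1 (fun _ : posreals R => 1 : R) x = 1.
  have [x0|x0] := leP x 0; first by rewrite !valL_out.
  by have [y ->] := posrealsE x0; rewrite !valL_pos.
split.
- exact: cst_continuous.
- by move=> x; exact: ltr01.
- by under eq_cvg do rewrite E; exact: cvg_cst.
- by under eq_cvg do rewrite E; exact: cvg_cst.
Qed.

Definition Fmul (f g : Fspace) : Fspace := MkFspace (Fspec_mul f g).
Definition Finv (f : Fspace) : Fspace := MkFspace (Fspec_inv f).
Definition Fone : Fspace := MkFspace Fspec_one.

Lemma F_gt0 (f : Fspace) x : 0 < f x.
Proof. by case: f => f []. Qed.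

Let FmulA : associative Fmul.
Proof. by move=> f g h; apply: Fspace_eq => x /=; rewrite mulrA. Qed.
Let Fmul1g : left_id Fone Fmul.
Proof. by move=> f; apply: Fspace_eq => x /=; rewrite mul1r. Qed.
Let Fmulg1 : right_id Fone Fmul.
Proof. by move=> f; apply: Fspace_eq => x /=; rewrite mulr1. Qed.
Let FmulVg : left_inverse Fone Finv Fmul.
Proof.
by move=> f; apply: Fspace_eq => x /=; rewrite mulVf// gt_eqF// F_gt0.
Qed.
Let FmulgV : right_inverse Fone Finv Fmul.
Proof.
by move=> f; apply: Fspace_eq => x /=; rewrite mulfV// gt_eqF// F_gt0.
Qed.

HB.instance Definition _ :=
  isGroup.Build Fspace FmulA Fmul1g Fmulg1 FmulVg FmulgV.

Lemma F_bounded (f : Fspace) : exists2 M, 0 < M & forall x, f x <= M.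
Proof.
case: f => f [cf f0 fl fr] /=.
have /cvgrPdist_lt /(_ 1 ltr01) [a /= a0 Ha] := fl.
have /cvgrPdist_lt /(_ 1 ltr01) [b [_ Hb]] := fr.
pose d := a / 2; pose K := Num.max d (b + 1).
have d0 : 0 < d by rewrite divr_gt0.
have dK : d <= K by rewrite le_max lexx.
have cw : {within `[d, K], continuous ('valL_1 f)}.
  have /continuous_subspaceW : {within posreals R, continuous ('valL_1 f)}.
    exact/subspace_valL_continuousP'.
  apply=> x /=; rewrite in_itv/= => /andP[dx _].
  exact: lt_le_trans dx.
have [c cdK Hc] := EVT_max dK cw.
exists (Num.max 2 ('valL_1 f c)); first by rewrite lt_max ltr0n.
move=> y; rewrite -(valL_pos f 1); have := posreals_gt0 y.
move: (set_val y) => {}y y0; rewrite le_max.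
have [yd|dy] := ltP y d.
  apply/orP; left; have := Ha y; rewrite /= sub0r normrN gtr0_norm//.
  have -> : y < a by move: yd; rewrite /d; lra.
  by move=> /(_ isT y0); rewrite ltr_norml => /andP[+ _]; lra.
have [yK|Ky] := leP y K.
  by apply/orP; right; apply: Hc; rewrite in_itv/= dy yK.
apply/orP; left; have /Hb : b < y.
  by move: Ky; rewrite gt_max => /andP[_]; lra.
by rewrite ltr_norml => /andP[+ _]; lra.
Qed.

Let rho_set (f g : Fspace) : set R := range (fun x => dpos (f x) (g x)).

Definition rho (f g : Fspace) : R := sup (range (fun x => dpos (f x) (g x))).

Let rho_has_sup f g : has_sup (rho_set f g).
Proof.
split; first by have [x _] := posrealsE (@ltr01 R); exists (dpos (f x) (g x)), x.
have [M1 _ H1] := F_bounded f; have [M2 _ H2] := F_bounded g.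
have [M3 _ H3] := F_bounded (Finv f); have [M4 _ H4] := F_bounded (Finv g).
exists (M1 + M2 + (M3 + M4)) => _ [x _ <-]; rewrite /dpos.
have := H1 x; have := H2 x; have := H3 x; have := H4 x => /=.
have := F_gt0 f x; have := F_gt0 g x.
have : 0 < (f x)^-1 by rewrite invr_gt0 F_gt0.
have : 0 < (g x)^-1 by rewrite invr_gt0 F_gt0.
move: (f x) (g x) (f x)^-1 (g x)^-1 => a b a' b' *.
by rewrite lerD// ler_norml; apply/andP; split; lra.
Qed.

Lemma rho_ub (f g : Fspace) x : dpos (f x) (g x) <= rho f g.
Proof. by apply: ub_le_sup; [case: (rho_has_sup f g)|exists x]. Qed.

Lemma rho_le (f g : Fspace) e : (forall x, dpos (f x) (g x) <= e) -> rho f g <= e.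
Proof.
by move=> h; apply: ge_sup; [case: (rho_has_sup f g)|move=> _ [x _ <-]].
Qed.

Let rhoxx f : rho f f = 0.
Proof.
apply/eqP; rewrite eq_le rho_le/=; last by move=> x; rewrite dposxx.
have [x _] := posrealsE (@ltr01 R).
by rewrite (le_trans (dpos_ge0 _ _) (rho_ub f f x)).
Qed.

Let rho_positivity f g : rho f g = 0 -> f = g.
Proof.
by move=> h; apply: Fspace_eq => x; apply: dpos_le0; rewrite -h rho_ub.
Qed.

Let rho_sym f g : rho f g = rho g f.
Proof. by congr sup; apply: eq_imagel => x _; rewrite dpos_sym. Qed.

Let rho_triangle g f h : rho f h <= rho f g + rho g h.
Proof.
apply: rho_le => x; rewrite (le_trans (dpos_triangle (g x) _ _))//.
by rewrite lerD// rho_ub.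
Qed.

HB.instance Definition _ :=
  isMetric.Build R Fspace rhoxx rho_positivity rho_sym rho_triangle.

Lemma Fspace_mdistE (f g : Fspace) : mdist f g = rho f g.
Proof. by []. Qed.

Lemma Fspace_mulE (f g : Fspace) x : (f * g)%g x = f x * g x.
Proof. by []. Qed.

End Fspace_def.

Section L1.
Context d (T : measurableType d) (R : realType).
Variable mu : {measure set T -> \bar R}.

Local Notation L1 := (LspaceType1 mu).

HB.instance Definition _ := gen_eqMixin L1.
HB.instance Definition _ := gen_choiceMixin L1.

(* Elements of LspaceType1 mu are classes modulo mu-a.e. equality; L1fun picks
   a representative. *)
Definition L1fun (g : L1) : T -> R := g.

Lemma L1fun_measurable (g : L1) : measurable_fun setT (L1fun g).
Proof. exact: (@measurable_funPT _ _ _ _ (repr (g : {mfun_ mu, T >-> measurableTypeR R}))). Qed.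

Lemma L1fun_finite (g : L1) : finite_norm mu 1 (L1fun g).
Proof. exact: Lebesgue_finite. Qed.

Lemma L1fun_Lfun (g : L1) : L1fun g \in Lfun mu 1.
Proof.
rewrite inE; apply/andP; split; rewrite inE/=.
  exact: L1fun_measurable.
exact: L1fun_finite.
Qed.

Lemma L1fun_integrable (g : L1) : mu.-integrable setT (EFin \o L1fun g).
Proof. exact/Lfun1_integrable/L1fun_Lfun. Qed.

Lemma L1_eq (g h : L1) : L1fun g = L1fun h %[ae mu] -> g = h.
Proof.
case: g h => g [[Pg]] [h [[Ph]]]; rewrite /L1fun/= => gh.
have {gh} E : g = h.
  rewrite -[g]reprK -[h]reprK; apply/eqmodP.
  exact/asboolP.
by case: _ / E in Ph *; rewrite (Prop_irrelevance Pg Ph).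
Qed.

Section class_of.
Variables (f : T -> R) (If : mu.-integrable setT (EFin \o f)).

Let mf : measurable_fun setT f.
Proof. by apply/measurable_EFinP; apply: measurable_int If. Qed.

Let fmfun : {mfun T >-> measurableTypeR R} :=
  HB.pack (f : T -> measurableTypeR R)
    (@isMeasurableFun.Build _ _ T (measurableTypeR R) f mf).

Let fpi : {mfun_ mu, T >-> measurableTypeR R} :=
  \pi_({mfun_ mu, T >-> measurableTypeR R})%qT fmfun.

Let fpiE : (fpi : T -> R) = f %[ae mu].
Proof.
have /eqmodP/asboolP : (repr fpi = fmfun
  %[mod {mfun_ mu, T >-> measurableTypeR R}])%qT by rewrite reprK.
exact.
Qed.

Let fpi_fin : finite_norm mu 1 fpi.
Proof.
have /integrableP[_ Hf] := If.
rewrite /finite_norm Lnorm1; apply: le_lt_trans Hf.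
rewrite le_eqVlt; apply/orP; left; apply/eqP.
apply: ae_eq_integral => //.
- apply: measurableT_comp => //; apply/measurable_EFinP.
  exact: (@measurable_funPT _ _ _ _ (repr fpi)).
- by apply: measurableT_comp => //; apply/measurable_EFinP.
- by apply: filterS fpiE => x /= h _; rewrite h.
Qed.

Definition L1class : L1 :=
  HB.pack fpi (isFinLebesgue.Build _ _ _ mu _ (@lexx _ _ 1%E) fpi fpi_fin).

Lemma L1classE : L1fun L1class = f %[ae mu].
Proof. exact: fpiE. Qed.

End class_of.

Definition L1dist (g h : L1) : R :=
  fine 'N[mu]_1[EFin \o (fun x => L1fun g x - L1fun h x)%R]%E.

Lemma L1distE g h :
  (L1dist g h)%:E = (\int[mu]_x `|(L1fun g x - L1fun h x)%:E|)%E.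
Proof.
rewrite /L1dist Lnorm1 fineK//.
have /integrableP[_ Hf] : mu.-integrable setT
    (fun x => (L1fun g x)%:E - (L1fun h x)%:E)%E.
  by apply: integrableB => //; exact: L1fun_integrable.
rewrite ge0_fin_numE; last exact: integral_ge0.
exact: Hf.
Qed.

Let mdiff g h : measurable_fun setT (fun x => (L1fun g x - L1fun h x)%:E).
Proof.
by apply/measurable_EFinP; apply: measurable_funB; exact: L1fun_measurable.
Qed.

Let L1distxx g : L1dist g g = 0.
Proof.
apply: EFin_inj; rewrite L1distE.
by under eq_integral do rewrite subrr abse0; rewrite integral0.
Qed.

Let L1dist_positivity g h : L1dist g h = 0 -> g = h.
Proof.
move=> L0; have := congr1 EFin L0; rewrite L1distE.
move=> /(ae_eq_integral_abs mu measurableT (mdiff g h)) H; apply: L1_eq.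
apply: filterS H => x /= h0 _; apply/eqP; rewrite -subr_eq0; apply/eqP.
exact/EFin_inj/h0.
Qed.

Let L1dist_sym g h : L1dist g h = L1dist h g.
Proof.
apply: EFin_inj; rewrite !L1distE; apply: eq_integral => x _ /=.
by rewrite distrC.
Qed.

Let mabs g h : measurable_fun setT (fun x => `|(L1fun g x - L1fun h x)%:E|)%E.
Proof. by apply: measurableT_comp => //; exact: mdiff. Qed.

Let L1dist_triangle h g k : L1dist g k <= L1dist g h + L1dist h k.
Proof.
rewrite -lee_fin EFinD !L1distE -ge0_integralD//; try exact: mabs.
apply: ge0_le_integral.
- by [].
- by move=> x _; exact: abse_ge0.
- exact: mabs.
- by apply: emeasurable_funD; exact: mabs.
- move=> x _; rewrite -EFinD lee_fin.
  by rewrite (le_trans _ (ler_normD _ _))// addrA subrK.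
Qed.

HB.instance Definition _ :=
  isMetric.Build R L1 L1distxx L1dist_positivity L1dist_sym L1dist_triangle.

Lemma L1_mdistE (g h : L1) :
  mdist g h = fine 'N[mu]_1[EFin \o (fun x => L1fun g x - L1fun h x)%R]%E.
Proof. by []. Qed.

End L1.

Section action.
Variable R : realType.

(* L^1((0,oo), lambda) is encoded as L^1 of R for the restriction of lambda to
   (0,oo): a.e. equality for lambda_pos is lambda-a.e. equality on (0,oo) and
   the norms agree. *)
Definition lambda_pos : {measure set (measurableTypeR R) -> \bar R} :=
  mrestr lebesgue_measure (@measurable_posreals R).

Definition L1pp_set : set (LspaceType1 lambda_pos) :=
  [set g | {ae lambda_pos, forall x, 0 < L1fun g x}].

Definition L1pp : Type := set_type L1pp_set.


Lemma valL_measurable (f : Fspace R) :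
  measurable_fun [set: measurableTypeR R] ('valL_1 f : measurableTypeR R -> R).
Proof.
have mp := @measurable_posreals R.
rewrite -(setUv (posreals R)); apply/measurable_funU => //.
  exact: measurableC.
split.
  apply: subspace_continuous_measurable_fun => //.
  by apply/subspace_valL_continuousP'; case: (FspaceP f).
apply: (eq_measurable_fun (cst (1 : R))); last exact: measurable_cst.
by move=> x /set_mem /negP; rewrite -leNgt => x0; rewrite valL_out.
Qed.

Lemma valL_bounded (f : Fspace R) : exists M, forall x, `|'valL_1 f x| <= M.
Proof.
have [M M0 HM] := F_bounded f; exists (M + 1) => x.
have [x0|x0] := leP x 0; first by rewrite valL_out// normr1 lerDr ltW.
have [y ->] := posrealsE x0; rewrite valL_pos gtr0_norm ?F_gt0//.
by rewrite (le_trans (HM y))// lerDl.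
Qed.

Lemma integrable_Fmul (f : Fspace R) (g : LspaceType1 lambda_pos) :
  lambda_pos.-integrable setT (EFin \o (fun x => 'valL_1 f x * L1fun g x)).
Proof.
have [M HM] := valL_bounded f.
apply: (integrableMr measurableT (valL_measurable f) _ (L1fun_integrable g)).
exists M; split; first exact: num_real.
by move=> t Mt x _ /=; rewrite (le_trans (HM x))// ltW.
Qed.

(* (f . g)(x) = f(x) g(x) on (0,oo); the value 1 given to f outside (0,oo)
   is irrelevant because lambda_pos does not charge (-oo,0]. *)
Definition L1mul (f : Fspace R) (g : LspaceType1 lambda_pos) :
  LspaceType1 lambda_pos := L1class (integrable_Fmul f g).

Lemma L1mulE f g :
  L1fun (L1mul f g) = (fun x => 'valL_1 f x * L1fun g x) %[ae lambda_pos].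
Proof. exact: L1classE. Qed.

Lemma L1mul_pp f g : L1pp_set g -> L1pp_set (L1mul f g).
Proof.
rewrite /L1pp_set/= => g0; have := L1mulE f g.
apply: filterS2 g0 => x g0 /(_ Logic.I) ->; rewrite mulr_gt0//.
have [x0|x0] := leP x 0; first by rewrite valL_out.
by have [y ->] := posrealsE x0; rewrite valL_pos F_gt0.
Qed.

Definition L1pp_act (f : Fspace R) (g : L1pp) : L1pp :=
  exist _ (L1mul f (set_val g)) (mem_set (L1mul_pp f (set_mem (valP g)))).

Lemma L1pp_actE (f : Fspace R) (g : L1pp) :
  {ae lambda_pos, forall x : R, forall x0 : 0 < x,
    L1fun (set_val (L1pp_act f g)) x =
    f (exist _ x (mem_set x0)) * L1fun (set_val g) x}.
Proof.
apply: filterS (L1mulE f (set_val g)) => x /(_ Logic.I) /= -> x0.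
by rewrite -(valL_pos f 1).
Qed.

End action.

(* Main.v *)
(* A label map into a countable set whose fibres have small diameter gives
   separability; both F and L^1 are labelled through the values of a continuous
   function on a fine grid of [0, N], rounded to a finite precision (elements of
   F are close to 1 beyond N, elements of L^1 are L^1-close to a continuous
   function cut off outside ]0, N]).  The metric rho is complete because uniform
   limits of f and 1/f are again inverse to each other, and L^1 is complete by
   the Riesz-Fischer argument.

   L^1_{++} is not closed in L^1.  Fix w > 0 in L^1 and let F_n(g) be the
   integral of (w - n g^+)^+.  Each F_n is n-Lipschitz, F_n(g) is nonincreasing
   in n, and F_n(g) --> 0 iff g > 0 a.e.  Adding sup_n |F_n(g) - F_n(h)| to the
   L^1-distance keeps the topology on L^1_{++} and makes it complete, since a
   uniform limit of null sequences is a null sequence. *)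

Require Import Defs.
From mathcomp Require Import all_boot all_order all_algebra.
From mathcomp Require Import all_classical all_reals all_analysis.
From mathcomp Require Import measurable_realfun lra ring.
Set Implicit Arguments.
Unset Strict Implicit.
Unset Printing Implicit Defensive.
Import Order.TTheory GRing.Theory Num.Theory.
Import numFieldNormedType.Exports.
Local Open Scope classical_set_scope.
Local Open Scope ring_scope.

(** * Separability and convergence in terms of a metric *)

Section metric_spaces.
Variable R : realType.

Lemma metrizes_mdist (T : metricType R) :
  metrizes (R := R) (T := T) mdist.
Proof. by move=> x; rewrite -metricType_numDomainType.nbhs_nbhs_mdist. Qed.

Lemma is_metric_mdist (T : metricType R) : is_metric (T := T) (@mdist R T).
Proof.
split.
- by move=> x y; split=> [/mdist_positivity//|->]; exact: mdistxx.
- exact: metric_sym.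
- exact: metric_triangle.
Qed.

(** A countable partition into sets of diameter at most [e]. Unlike a countable dense set, it
    restricts to any subspace, which is how the cone inherits separability from L^1. *)
Definition countably_labelled (T : Type) (d : T -> T -> R) (e : R) : Prop :=
  exists c : T -> nat, forall x y, c x = c y -> d x y < e.

Lemma labelled (T : Type) (d : T -> T -> R) (e : R) (C : countType)
  (c : T -> C) : (forall x y, c x = c y -> d x y < e) -> countably_labelled d e.
Proof. by move=> h; exists (pickle \o c) => x y /(pcan_inj pickleK)/h. Qed.

Lemma separable_labelled (T : topologicalType) (d : T -> T -> R) :
  metrizes d -> (forall e, 0 < e -> countably_labelled d e) ->
  separable_space T.
Proof.
move=> md cd.
have [[x0]|T0] := pselect (inhabited T); last first.
  by exists set0 => // O [x]; case: T0.
have /choice[c cP] (n : nat) := cd n.+1%:R^-1 ltac:(by rewrite invr_gt0 ltr0n).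
(* [r (n, i)] represents the fibre of [c n] over [i], with the default [x0] for an empty fibre. A
   point shares its label with the representative of its own fibre, hence lies within [1/(n+1)] of
   it. *)
have /choice[r rP] (p : nat * nat) : exists y : T,
    (exists x, c p.1 x = p.2) -> c p.1 y = p.2.
  by have [[x h]|h] := pselect (exists x, c p.1 x = p.2); [exists x|exists x0].
exists (range r); first by apply: sub_countable (card_image_le _ _) _;
  exact: countableP.
move=> O [x Ox] oO; have : nbhs x O by exact: open_nbhs_nbhs.
rewrite (md x) => -[e /= e0 xeO].
have [n ne] : exists n : nat, n.+1%:R^-1 < e.
  by have := ltr_add_invr e0 => -[n]; rewrite add0r; exists n.
exists (r (n, c n x)); split; last by exists (n, c n x).
apply: xeO => /=; apply: lt_trans ne; apply: cP.
by rewrite (rP (n, c n x))//; exists x.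
Qed.

Lemma countably_labelled_sub (T U : Type) (i : T -> U) (d : U -> U -> R) e :
  countably_labelled d e -> countably_labelled (fun x y => d (i x) (i y)) e.
Proof. by move=> [c cP]; exists (c \o i) => x y /cP. Qed.

Lemma metrizes_cvgP (T : topologicalType) (d : T -> T -> R) (I : Type)
    (F : set_system I) {FF : Filter F} (f : I -> T) (l : T) :
  metrizes d ->
  f @ F --> l <-> forall e, 0 < e -> \forall i \near F, d l (f i) < e.
Proof.
move=> md; split=> [fl e e0|h].
  by have /fl : nbhs l [set z | d l z < e] by rewrite (md l); exists e.
move=> A; rewrite (md l) => -[e /= e0 eA].
by apply: filterS (h _ e0) => i /= /eA.
Qed.

End metric_spaces.

(** * Continuous real functions: labels on a segment, uniform limits *)

Section continuous_functions.
Variable R : realType.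

Lemma segment_unif_continuous (a b : R) (h : R -> R) (e : R) :
  continuous h -> 0 < e -> exists2 r, 0 < r &
    forall x y, x \in `[a, b] -> `|x - y| < r -> `|h x - h y| < e.
Proof.
move=> ch e0; have e2 : 0 < e / 2 by rewrite divr_gt0.
have /compact_near_coveringP/(_ R 0^'+
  (fun r x => forall y, `|x - y| < r -> `|h x - h y| < e)) :=
  @segment_compact R a b.
case=> [x _|r /= r0 rP]; last first.
  exists (r / 2); first by rewrite divr_gt0.
  move=> x y xab; apply: (rP (r / 2)) => /=.
  - by rewrite sub0r normrN gtr0_norm ?divr_gt0// ltr_pdivrMr// ltr_pMr// ltr1n.
  - by rewrite divr_gt0.
  - exact: xab.
have /cvgrPdist_lt/(_ _ e2)[r /= r0 rP] := ch x.
(* If [x'] is within [r / 2] of [x] and [y] within [s < r / 2] of [x'], then both stay within [r] of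
   [x]. *)
exists (ball x (r / 2), [set s | s < r / 2]) => /=.
  split; first by apply: nbhsx_ballx; rewrite divr_gt0.
  by apply: nbhs_right_lt; rewrite divr_gt0.
move=> [x' s] [/= xx' sr] y yx'.
rewrite -(subrK (h x) (h x')) -addrA (le_lt_trans (ler_normD _ _))//.
have hx : `|h x - h x'| < e / 2.
  apply: rP => /=; apply: lt_trans xx' _.
  by rewrite ltr_pdivrMr// ltr_pMr// ltr1n.
have hy : `|h x - h y| < e / 2.
  apply: rP => /=; rewrite -(subrK x' x) -addrA (le_lt_trans (ler_normD _ _))//.
  by move: xx'; rewrite /ball/=; lra.
by rewrite distrC; lra.
Qed.

(** The label records a mesh on which the function oscillates by less than [e / 4], and the values
    at the grid points rounded to precision [1 / K < e / 4]. Equal labels mean a common mesh, and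
    two oscillations plus one rounding stay below [e]. *)
Lemma segment_continuous_labelled (N : nat) (e : R) : 0 < e ->
  exists c : (R -> R) -> nat, forall h k, continuous h -> continuous k ->
    c h = c k -> forall x, x \in `[0, N%:R] -> `|h x - k x| < e.
Proof.
move=> e0; have e4 : 0 < e / 4 by rewrite divr_gt0.
have [K K0] : exists2 K : R, 0 < K & K^-1 < e / 4.
  exists (1 + (e / 4)^-1); first by rewrite addr_gt0 ?invr_gt0.
  rewrite invf_plt ?posrE//; first by rewrite ltrDr.
  by rewrite addr_gt0 ?invr_gt0.
move=> Ke.
have /choice[m mP] (h : R -> R) : exists m : nat, continuous h ->
    forall x y, x \in `[0, N%:R] -> `|x - y| < m.+1%:R^-1 ->
    `|h x - h y| < e / 4.
  have [ch|] := pselect (continuous h); last by exists 0%N.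
  have [r r0 rP] := segment_unif_continuous 0 N%:R ch e4.
  have [m] := ltr_add_invr r0; rewrite add0r => mr.
  by exists m => _ x y xN xy; apply: rP => //; exact: lt_trans mr.
pose grid (h : R -> R) (i : nat) : int :=
  Num.floor (K * h (i%:R / (m h).+1%:R)).
(* The final successor keeps the right end [N] in the grid; it is the grid point used for
   [x = N]. *)
pose c (h : R -> R) := (m h, [seq grid h i | i <- iota 0 (N * (m h).+1).+1]).
exists (pickle \o c) => h k ch ck /(pcan_inj pickleK) hk x xN.
have /= mhk : (c h).1 = (c k).1 by rewrite hk.
have ghk : [seq grid h i | i <- iota 0 (N * (m h).+1).+1] =
    [seq grid k i | i <- iota 0 (N * (m k).+1).+1] := congr1 snd hk.
have m0 : 0 < (m h).+1%:R :> R by rewrite ltr0n.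
have x0 : 0 <= x * (m h).+1%:R.
  by rewrite mulr_ge0//; move: xN; rewrite in_itv/= => /andP[].
pose i := Num.truncn (x * (m h).+1%:R).
have /andP[ix xi] := truncn_itv x0.
have iN : (i < (N * (m h).+1).+1)%N.
  rewrite ltnS -(ler_nat R) natrM; apply: le_trans ix _.
  by rewrite ler_pM2r//; move: xN; rewrite in_itv/= => /andP[].
have xy : `|x - i%:R / (m h).+1%:R| < (m h).+1%:R^-1.
  rewrite -[X in `|X - _|](mulfK (lt0r_neq0 m0)) -mulrBl normrM.
  rewrite (@gtr0_norm _ (_^-1)) ?invr_gt0// gtr_pMl ?invr_gt0//.
  by rewrite ger0_norm ?subr_ge0// ltrBlDl natr1.
have hi := mP h ch _ _ xN xy.
have ki : `|k x - k (i%:R / (m h).+1%:R)| < e / 4 by rewrite mhk in xy *;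
  exact: (mP k ck).
have : grid h i = grid k i.
  have := congr1 (fun s => nth 0 s i) ghk.
  rewrite (nth_map 0%N) ?size_iota// (nth_map 0%N) ?size_iota -?mhk//.
  by rewrite !nth_iota.
rewrite /grid -mhk; move: (h (_ / _)) (k (_ / _)) hi ki => u v hi ki uv.
have uvK : `|u - v| < e / 4.
  apply: lt_trans Ke; rewrite -(@ltr_pM2l _ K)// divff ?gt_eqF//.
  rewrite -[X in X * _]gtr0_norm// -normrM.
  have := floor_le (K * u); have := floorD1_gt (K * u).
  have := floor_le (K * v); have := floorD1_gt (K * v).
  by rewrite uv intrD ltr_norml; lra.
move: hi ki uvK; rewrite !ltr_norml; lra.
Qed.

(** Interchange of limits by an [e / 3] argument. Over a general filter it yields both the
    continuity of a uniform limit and its limits at 0 and at infinity. *)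
Lemma uniform_limit_cvg (T : Type) (F : set_system T) (FF : ProperFilter F)
    (f : T -> R) (b : R) :
  (forall e, 0 < e -> exists (g : T -> R) (a : R),
     [/\ forall t, `|f t - g t| <= e, `|b - a| <= e & g @ F --> a]) ->
  f @ F --> b.
Proof.
move=> h; apply/cvgrPdist_lt => e e0.
have e3 : 0 < e / 3 by rewrite divr_gt0.
have [g [a [fg ba /cvgrPdist_lt/(_ _ e3)]]] := h _ e3.
by apply: filterS => t; have := fg t; move: ba; rewrite !ler_norml !ltr_norml;
  lra.
Qed.

Lemma seq_cauchy_cvg (u : nat -> R) :
  (forall e, 0 < e -> exists N : nat, forall m n : nat,
     (N <= m)%N -> (N <= n)%N -> `|u m - u n| < e) -> cvg (u @ \oo).
Proof.
move=> h; apply/cauchy_cvgP/cauchyP => e e0; have [N NP] := h _ e0.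
by exists (u N); exists N => // n /= Nn; exact: NP.
Qed.

End continuous_functions.

(** * The group F *)

Section Fspace_polish.
Variable R : realType.
Implicit Types f g : Fspace R.

(** At 0 this is exactly the condition that [f] tends to 1 there. It lets the labels on the compact
    segment [[0, N]] apply to elements of F. *)
Lemma Fext_continuous f : continuous ('valL_1 f : R -> R).
Proof.
have [cf _ fl _] := FspaceP f.
move=> x; have [x0|x0|->] := ltgtP x 0.
- have : \forall y \near x, 1 = 'valL_1 f y :> R.
    near=> y; rewrite valL_out// ltW//; near: y; exact: lt_nbhsl.
  move=> h; rewrite /continuous_at (valL_out _ _ (ltW x0)).
  by apply: cvg_trans (near_eq_cvg h) _; exact: cvg_cst.
- have oP : open (posreals R) by exact: open_gt.
  have /subspace_valL_continuousP' := cf.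
  move=> /(_ 1); rewrite continuous_open_subspace//.
  by apply; rewrite inE.
- rewrite /continuous_at (valL_out _ _ (lexx 0)); apply/cvgrPdist_lt => e e0.
  have /cvgrPdist_lt/(_ _ e0)[r /= r0 rP] := fl.
  exists r => // y /= yr; suff : `|1 - 'valL_1 f y| < e by [].
  have [y0|y0] := leP y 0; last exact: rP.
  by rewrite valL_out// subrr normr0.
Unshelve. all: by end_near. Qed.

Lemma ler_dpos (x y : R) : `|x - y| <= dpos x y.
Proof. by rewrite lerDl. Qed.

Lemma ler_dposV (x y : R) : `|x^-1 - y^-1| <= dpos x y.
Proof. by rewrite lerDr. Qed.

Lemma dposV (x y : R) : dpos x^-1 y^-1 = dpos x y.
Proof. by rewrite /dpos !invrK addrC. Qed.

(** From [a b - a' b' = a (b - b') + b' (a - a')], used once for the numbers and once for their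
    inverses. *)
Lemma dpos_mul (M N x y x' y' : R) : 0 < x -> x <= M -> x^-1 <= M ->
  0 < y' -> y' <= N -> y'^-1 <= N ->
  dpos (x * y) (x' * y') <= M * dpos y y' + N * dpos x x'.
Proof.
move=> x0 xM xVM y0 yN yVN.
have mulB (a b a' b' : R) : 0 < a -> a <= M -> 0 < b' -> b' <= N ->
    `|a * b - a' * b'| <= M * `|b - b'| + N * `|a - a'|.
  move=> a0 aM b0 bN.
  have -> : a * b - a' * b' = a * (b - b') + b' * (a - a') by ring.
  rewrite (le_trans (ler_normD _ _))// !normrM (gtr0_norm a0) (gtr0_norm b0).
  by rewrite lerD// ler_wpM2r.
have := mulB x y x' y' x0 xM y0 yN.
have := mulB x^-1 y^-1 x'^-1 y'^-1; rewrite !invr_gt0 -!invfM.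
by move=> /(_ x0 xVM y0 yVN); rewrite /dpos; lra.
Qed.

Lemma F_bounded2 f : exists2 M, 0 < M & forall x, f x <= M /\ (f x)^-1 <= M.
Proof.
have [M M0 MP] := F_bounded f; have [N N0 NP] := F_bounded (f^-1)%g.
exists (M + N) => [|x]; first exact: addr_gt0.
by have := MP x; have := NP x; rewrite /=; split; lra.
Qed.

Lemma Fmul_continuous : continuous (fun p :
  Fspace R * Fspace R => (p.1 * p.2)%g).
Proof.
move=> [f g].
apply/(@metricType_numDomainType.cvgrPdist_lt _ _ _ (nbhs (f, g)) _) => e e0.
have [M M0 MP] := F_bounded2 f; have [N N0 NP] := F_bounded2 g.
have K0 : 0 < M + N + 2 by lra.
(* [r <= 1] bounds [g'] and its inverse by [N + 1], so the distance of the products is at most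
   [(M + N + 1) r]; the constant 2 makes this strictly less than [e]. *)
pose r := Num.min 1 (e / (M + N + 2)).
have r0 : 0 < r by rewrite lt_min ltr01 divr_gt0.
have r1 : r <= 1 by rewrite ge_min lexx.
have re : r * (M + N + 2) <= e by rewrite -ler_pdivlMr// ge_min lexx orbT.
exists (ball f r, ball g r); first by split; exact: nbhsx_ballx.
move=> [f' g'] /= []; rewrite !ballEmdist/= !Fspace_mdistE => ff' gg'.
have : rho (f * g)%g (f' * g')%g <= M * r + (N + 1) * r.
  apply: rho_le => x; rewrite !Fspace_mulE.
  have gx := le_trans (rho_ub g g' x) (ltW gg').
  have fx := le_trans (rho_ub f f' x) (ltW ff').
  have [fM fVM] := MP x; have [gN gVN] := NP x.
  have := le_trans (ler_dpos _ _) gx; rewrite ler_norml => /andP[g1 _].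
  have := le_trans (ler_dposV _ _) gx; rewrite ler_norml => /andP[g2 _].
  apply: (le_trans (@dpos_mul M (N + 1) _ _ _ _ _ _ _ _ _ _)) => //;
    rewrite ?F_gt0//; [lra|lra|].
  by rewrite lerD// ler_wpM2l//; lra.
by nra.
Qed.

(** [dpos] is invariant under inversion of both arguments, so inversion is an isometry for [rho]. *)
Lemma Finv_continuous : continuous (fun f : Fspace R => f^-1%g).
Proof.
move=> f.
apply/(@metricType_numDomainType.cvgrPdist_lt _ _ _ (nbhs f) _) => e e0.
apply: (@filterS _ (nbhs f) _ _ _ _ (nbhsx_ballx f _ e0)) => g;
  rewrite ballEmdist/=.
apply: le_lt_trans; apply: rho_le => x.
by rewrite /= dposV; exact: rho_ub.
Qed.

(** Beyond [N f], the functions and their inverses are within [e / 8] of 1, giving four errors of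
    [e / 8]; on [[0, N f]] the labels give two errors of [e / 4]. The target is [e / 2] because a
    supremum loses strictness. *)
Lemma Fspace_labelled (e : R) : 0 < e ->
  countably_labelled (@mdist R (Fspace R)) e.
Proof.
move=> e0; have e4 : 0 < e / 4 by rewrite divr_gt0.
have /choice[N NP] f : exists N : nat, forall x : posreals R,
    N%:R < set_val x -> `|f x - 1| < e / 8 /\ `|(f x)^-1 - 1| < e / 8.
  have e8 : 0 < e / 8 by rewrite divr_gt0.
  have [_ _ _ /cvgrPdist_lt/(_ _ e8)[a [_ aP]]] := FspaceP f.
  have [_ _ _ /cvgrPdist_lt/(_ _ e8)[b [_ bP]]] := FspaceP (f^-1)%g.
  exists (Num.truncn (Num.max a b)).+1 => x xN.
  have {}xN := lt_trans (truncnS_gt _) xN.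
  have := xN; rewrite gt_max => /andP[/aP + /bP].
  by rewrite !valL_pos/= distrC => ? ; rewrite distrC.
have /choice[c cP] (n : nat) := segment_continuous_labelled n e4.
pose l f := (N f, (c (N f) ('valL_1 f), c (N f) ('valL_1 (f^-1)%g))).
apply: (@labelled _ _ _ _ _ l) => f g fg; have Nfg : N f = N g := congr1 fst fg.
have c1 : c (N f) ('valL_1 f) = c (N g) ('valL_1 g) :=
  congr1 (fun p => p.2.1) fg.
have c2 : c (N f) ('valL_1 (f^-1)%g) = c (N g) ('valL_1 (g^-1)%g) :=
  congr1 (fun p => p.2.2) fg.
rewrite -Nfg in c1 c2.
have : mdist f g <= e / 2; last by lra.
rewrite Fspace_mdistE; apply: rho_le => x.
have [xN|Nx] := leP (set_val x) (N f)%:R; last first.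
  have [] := NP f x Nx; rewrite Nfg in Nx; have [] := NP g x Nx.
  rewrite /dpos => g1 g2 f1 f2.
  have tri (a b : R) : `|a - b| <= `|a - 1| + `|b - 1|.
    by rewrite (distrC b) (le_trans _ (ler_normD _ _))// addrA subrK.
  by have := tri (f x) (g x); have := tri (f x)^-1 (g x)^-1; lra.
have x0N : set_val x \in `[0, (N f)%:R] by rewrite in_itv/= xN ltW//
  posreals_gt0.
have := cP _ _ _ (Fext_continuous (f:=f)) (Fext_continuous (f:=g)) c1 _ x0N.
have := cP _ _ _ (Fext_continuous (f:=(f^-1)%g))
  (Fext_continuous (f:=(g^-1)%g)) c2 _ x0N.
by rewrite !valL_pos /dpos /=; lra.
Qed.

Lemma Fspace_complete : metric_complete (T := Fspace R) (@mdist R (Fspace R)).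
Proof.
move=> u uC.
have uCx x e : 0 < e -> exists N : nat, forall m n : nat,
    (N <= m)%N -> (N <= n)%N -> dpos (u m x) (u n x) < e.
  move=> /uC[N NP]; exists N => m n Nm Nn.
  by apply: le_lt_trans (NP _ _ Nm Nn); exact: rho_ub.
have /choice[l lP] (x : posreals R) : exists l : R, u n x @[n --> \oo] --> l.
  apply/cvg_ex/seq_cauchy_cvg => e /(uCx x)[N NP]; exists N => m n Nm Nn.
  exact: le_lt_trans (ler_dpos _ _) (NP _ _ Nm Nn).
have /choice[k kP] (x : posreals R) : exists k :
  R, (u n x)^-1 @[n --> \oo] --> k.
  apply/cvg_ex/seq_cauchy_cvg => e /(uCx x)[N NP]; exists N => m n Nm Nn.
  exact: le_lt_trans (ler_dposV _ _) (NP _ _ Nm Nn).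
(* Positive numbers could tend to 0; the convergence of the inverses excludes this. *)
have lk x : l x * k x = 1.
  apply: (cvg_unique _ (cvgM (lP x) (kP x))); first exact: norm_hausdorff.
  rewrite (_ : _ \* _ = cst 1); first exact: cvg_cst.
  by apply/funext => n /=; rewrite mulfV// gt_eqF// F_gt0.
have l0 x : 0 < l x.
  rewrite lt_neqAle eq_sym; apply/andP; split.
    apply/eqP => lx0; have := lk x; rewrite lx0 mul0r => /eqP.
    by rewrite eq_sym oner_eq0.
  rewrite -(cvg_lim (@norm_hausdorff _ R) (lP x)); apply: limr_ge.
    exact: cvgP (lP x).
  by apply: nearW => n; rewrite ltW// F_gt0.
have kE x : k x = (l x)^-1.
  by rewrite -[LHS](mulKf (lt0r_neq0 (l0 x))) lk mulr1.
(* Letting [m] tend to infinity in the Cauchy estimate makes the pointwise convergence uniform in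
   [x]. *)
have ul e : 0 < e -> exists N : nat, forall n x, (N <= n)%N ->
    dpos (l x) (u n x) <= e.
  move=> /uC[N NP]; exists N => n x Nn.
  have h : dpos (u m x) (u n x) @[m --> \oo] --> dpos (l x) (u n x).
    apply: cvgD; apply: cvg_norm; apply: cvgB; try exact: cvg_cst.
      exact: lP.
    by rewrite -kE; exact: kP.
  rewrite -(cvg_lim (@norm_hausdorff _ R) h); apply: limr_le.
    exact: cvgP h.
  exists N => // m /= Nm; apply/ltW/(le_lt_trans (rho_ub (u m) (u n) x)).
  exact: NP.
have ulv e : 0 < e -> exists n, forall t, `|'valL_1 l t - 'valL_1 (u n) t| <= e.
  move=> e0; have [N NP] := ul e e0; exists N => t; have [t0|t0] := leP t 0.
    by rewrite !valL_out// subrr normr0 ltW.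
  have [y ->] := posrealsE t0; rewrite !valL_pos.
  exact: le_trans (ler_dpos _ _) (NP N y (leqnn N)).
have lspec : Fspec l.
  split => //.
  - move=> x; apply: (@uniform_limit_cvg _ _ (nbhs x) _) => e /ul[N NP].
    exists (u N), (u N x); split.
    + by move=> y; exact: le_trans (ler_dpos _ _) (NP N y (leqnn N)).
    + by exact: le_trans (ler_dpos _ _) (NP N x (leqnn N)).
    + by have [cu _ _ _] := FspaceP (u N); exact: cu.
  - apply: uniform_limit_cvg => e e0; have [n nP] := ulv e e0.
    exists ('valL_1 (u n)), 1; split => //; first by rewrite subrr normr0 ltW.
    by have [] := FspaceP (u n).
  - apply: uniform_limit_cvg => e e0; have [n nP] := ulv e e0.
    exists ('valL_1 (u n)), 1; split => //; first by rewrite subrr normr0 ltW.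
    by have [] := FspaceP (u n).
exists (MkFspace lspec).
apply/(metrizes_cvgP _ _ (@metrizes_mdist R (Fspace R))) => e e0.
have e2 : 0 < e / 2 by rewrite divr_gt0.
have [N NP] := ul _ e2; exists N => // n /= Nn.
have : mdist (MkFspace lspec) (u n) <= e / 2; last by lra.
by rewrite Fspace_mdistE; apply: rho_le => x; exact: NP.
Qed.

Lemma Fspace_polish_group : polish_group R (Fspace R).
Proof.
split; first by split; [exact: Fmul_continuous|exact: Finv_continuous].
split.
  by apply: separable_labelled (@metrizes_mdist R (Fspace R)) _;
    exact: Fspace_labelled.
exists (@mdist R (Fspace R)); split;
  [exact: is_metric_mdist|exact: metrizes_mdist|].
exact: Fspace_complete.
Qed.

End Fspace_polish.

(** * Completeness of L^1 *)

Section L1_space.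
Context d (T : measurableType d) (R : realType).
Variable mu : {measure set T -> \bar R}.
Local Notation L1 := (LspaceType1 mu).
Implicit Types g h : L1.

Lemma mdist_L1E g h :
  (mdist g h)%:E = (\int[mu]_x `|(L1fun g x - L1fun h x)%:E|)%E.
Proof. exact: L1distE. Qed.

Lemma mdist_L1class g (f : T -> R) (If : mu.-integrable setT (EFin \o f)) :
  (mdist g (L1class If))%:E = (\int[mu]_x `|(L1fun g x - f x)%:E|)%E.
Proof.
rewrite mdist_L1E; apply: ae_eq_integral => //.
- apply: measurableT_comp => //; apply/measurable_EFinP.
  by apply: measurable_funB; exact: L1fun_measurable.
- apply: measurableT_comp => //; apply/measurable_EFinP.
  apply: measurable_funB; first exact: L1fun_measurable.
  by apply/measurable_EFinP/(measurable_int mu).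
- by apply: filterS (L1classE If) => x /= h _; rewrite h.
Qed.

Lemma mdist_L1class2 (f h : T -> R) (If : mu.-integrable setT (EFin \o f))
    (Ih : mu.-integrable setT (EFin \o h)) :
  (mdist (L1class If) (L1class Ih))%:E = (\int[mu]_x `|(f x - h x)%:E|)%E.
Proof.
have mf : measurable_fun setT f by apply/measurable_EFinP/(measurable_int mu).
rewrite mdist_L1class; apply: ae_eq_integral => //.
- apply: measurableT_comp => //; apply/measurable_EFinP.
  apply: measurable_funB; first exact: L1fun_measurable.
  by apply/measurable_EFinP/(measurable_int mu).
- apply: measurableT_comp => //; apply/measurable_EFinP.
  by apply: measurable_funB => //; apply/measurable_EFinP/(measurable_int mu).
- by apply: filterS (L1classE If) => x /= fx _; rewrite fx.
Qed.

Lemma mdist_L1class2_Rintegral (f h : T -> R)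
    (If : mu.-integrable setT (EFin \o f))
    (Ih : mu.-integrable setT (EFin \o h)) :
  mdist (L1class If) (L1class Ih) = \int[mu]_x `|f x - h x|.
Proof. by apply: EFin_inj; rewrite mdist_L1class2 /Rintegral -(mdist_L1class2
  If Ih). Qed.

(** The sum [S] of the successive differences has integral at most [1/2 + 1/4 + ... = 1], so it is
    finite a.e. and the telescoping series converges absolutely there. The function [|w 0| + S] then
    dominates the whole sequence. *)
Lemma L1_fast_cauchy_cvg (v : nat -> L1) :
  (forall k, mdist (v k.+1) (v k) <= (2 ^ k.+1)%:R^-1) ->
  exists l : L1, v @ \oo --> l.
Proof.
move=> vC; pose w k x := L1fun (v k) x.
have mw k : measurable_fun setT (w k) by exact: L1fun_measurable.
pose D k x := (`|(w k.+1 x - w k x)%:E|)%E.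
have mD k : measurable_fun setT (D k).
  by apply: measurableT_comp => //; apply/measurable_EFinP;
    exact: measurable_funB.
have D0 k x : (0 <= D k x)%E by exact: abse_ge0.
pose S x := (\sum_(0 <= k <oo) D k x)%E.
have mS : measurable_fun setT S by apply: ge0_emeasurable_sum.
have S0 x : (0 <= S x)%E by apply: nneseries_ge0.
have S1 : (\int[mu]_x S x <= 1)%E.
  rewrite integral_nneseries//.
  apply: le_trans (@epsilon_trick0 R 1 xpredT ler01).
  apply: lee_nneseries => [k _ _|k _]; first exact: integral_ge0.
  by rewrite -mdist_L1E div1r lee_fin.
have IS : mu.-integrable setT S.
  apply/integrableP; split => //.
  under eq_integral do rewrite gee0_abs//.
  by rewrite (le_lt_trans S1)// ltry.
have sumD n x : (`|(w n x)%:E| <= `|(w 0%N x)%:E| + S x)%E.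
  apply: le_trans (leeD (lexx _) (nneseries_lim_ge (m := 0%N) n _)) => //.
  elim: n => [|n IH]; first by rewrite big_geq// adde0.
  rewrite big_nat_recr//= addeA; apply: le_trans (leeD IH (lexx _)).
  by rewrite /D/= -EFinD lee_fin -{1}(subrK (w n x) (w n.+1 x)) addrC ler_normD.
have wcvg x : S x \is a fin_num -> cvgn (fun n => w n x).
  move=> Sx.
  have : cvgn (series (telescope (fun n => w n x))).
    apply: normed_cvg; apply: nondecreasing_is_cvgn.
      apply/nondecreasing_seqP => n; rewrite [leRHS]big_nat_recr// lerDl.
      exact: normr_ge0.
    exists (fine (S x)) => _ [n _ <-];
      rewrite -lee_fin fineK// /series/= -sumEFin.
    exact: (nneseries_lim_ge (m := 0%N) n).
  set t := series _ => ct.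
  rewrite (_ : (fun n => w n x) = cst (w 0%N x) \+ t); last first.
    by apply/funext => n; exact: (eq_sum_telescope (fun n => w n x)).
  exact: is_cvgD (is_cvg_cst _) ct.
(* The upper limit is measurable on all of [T] and equals the limit wherever [w n x] converges. *)
pose l x := fine (limn_esup (fun n => (w n x)%:E)).
have ml : measurable_fun setT l.
  apply: measurableT_comp => //; apply: measurable_fun_limn_esup => n.
  exact/measurable_EFinP.
have wl : {ae mu, forall x, setT x -> (w n x)%:E @[n --> \oo] --> (l x)%:E}.
  apply: filterS (integrable_ae measurableT IS) => x /(_ Logic.I)/wcvg.
  move=> /cvg_ex[a wa] _; have {}wa : (w n x)%:E @[n --> \oo] --> a%:E.
    by apply/cvg_EFin => //; exact: nearW.
  by rewrite /l (is_cvg_limn_esupE (cvgP _ wa)) (cvg_lim _ wa).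
have [] := @dominated_convergence _ _ _ mu setT measurableT
  (fun n x => (w n x)%:E) (EFin \o l) (fun x => `|(w 0%N x)%:E| + S x)%E.
- by move=> n; exact/measurable_EFinP.
- exact/measurable_EFinP.
- exact: wl.
- by apply: integrableD => //; apply: integrable_abse; exact: L1fun_integrable.
- by apply: aeW => x n _; exact: sumD.
move=> Il cl _; exists (L1class Il).
apply/(metrizes_cvgP _ _ (@metrizes_mdist R _)) => e e0.
have /fine_cvgP[_ /cvgrPdist_lt/(_ _ e0)] := cl.
apply: filterS => n /=; rewrite sub0r normrN => /(le_lt_trans (ler_norm _)).
by rewrite metric_sym -(mdist_L1class (v n) Il).
Qed.

Lemma L1_complete : metric_complete (T := L1) (@mdist R L1).
Proof.
move=> u uC.
have /choice[N NP] (k : nat) :=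
  uC (2 ^ k.+1)%:R^-1 ltac:(by rewrite invr_gt0 ltr0n expn_gt0).
(* The maximum makes [p] nondecreasing with [N k <= p k]; the summand [k] makes it unbounded. *)
pose p k := (k + \max_(i < k.+1) N i)%N.
have Np k : (N k <= p k)%N 
  by apply: leq_trans (leq_addl _ _); rewrite big_ord_recr/= leq_maxr.
have pp k : (p k <= p k.+1)%N by rewrite /p [in leqRHS]big_ord_recr/= leq_add//
  leq_maxl.
have [l lP] : exists l : L1, (u \o p) @ \oo --> l.
  apply: L1_fast_cauchy_cvg => k; apply/ltW/NP => //=.
  exact: leq_trans (Np k) (pp k).
exists l; apply/(metrizes_cvgP _ _ (@metrizes_mdist R _)) => e e0.
have e2 : 0 < e / 2 by rewrite divr_gt0.
have [M MP] := uC _ e2.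
have /(metrizes_cvgP _ _ (@metrizes_mdist R _))/(_ _ e2)[K _ KP] := lP.
exists M => // n /= Mn.
pose k := maxn K M.
have Mk : (M <= p k)%N.
  exact: leq_trans (leq_maxr K M) (leq_addr _ _).
have lk : mdist l (u (p k)) < e / 2 by apply: KP; exact: leq_maxl.
have := MP _ _ Mk Mn; have := metric_triangle l (u (p k)) (u n); lra.
Qed.

End L1_space.

(** * Complete metrics on subspaces *)

Section subspaces.
Variables (R : realType) (T : metricType R).

Lemma metrizes_set_type (P : set T) :
  metrizes (T := set_type P) (fun x y :
    set_type P => mdist (set_val x) (set_val y)).
Proof.
move=> x; rewrite -nbhs_ballE; apply/seteqP; split=> A -[e /= e0 eA];
  exists e => //= y h; apply: eA.
  by rewrite -initial_ballE /= ballEmdist.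
by move: h; rewrite -initial_ballE /= ballEmdist.
Qed.

Lemma near_forall_leq (I : Type) (G : set_system I) {FG : Filter G}
    (Q : nat -> I -> Prop) (N : nat) :
  (forall n, \forall i \near G, Q n i) ->
  \forall i \near G, forall n, (n <= N)%N -> Q n i.
Proof.
move=> GQ; elim: N => [|N IH].
  by apply: filterS (GQ 0%N) => i Qi n; rewrite leqn0 => /eqP ->.
apply: filterS2 (GQ N.+1) IH => i QN Qi n; rewrite leq_eqVlt => /orP[/eqP->//|].
exact: Qi.
Qed.

Variables (P : set T) (F : nat -> T -> R).
Hypothesis F_continuous : forall n, continuous (F n).
Hypothesis F_ge0 : forall n x, 0 <= F n x.
Hypothesis F_noninc : forall x, {homo F^~ x : m n / (m <= n)%N >-> n <= m}.
Hypothesis PE : forall x, P x <-> F n x @[n --> \oo] --> 0.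

Let q (x y : T) : R := sup (range (fun n => `|F n x - F n y|)).

Let q_has_sup x y : has_sup (range (fun n => `|F n x - F n y|)).
Proof.
split; first by exists (`|F 0%N x - F 0%N y|), 0%N.
(* Nonnegative and nonincreasing, the two sequences are bounded by their initial terms, so the
   supremum is a genuine real number. *)
exists (F 0%N x + F 0%N y) => _ [n _ <-].
rewrite (le_trans (ler_normB _ _))// !ger0_norm//.
by rewrite lerD// F_noninc.
Qed.

Let q_ub x y n : `|F n x - F n y| <= q x y.
Proof. by apply: ub_le_sup; [case: (q_has_sup x y)|exists n]. Qed.

Let q_le x y e : (forall n, `|F n x - F n y| <= e) -> q x y <= e.
Proof. by move=> h; apply: ge_sup;
  [case: (q_has_sup x y)|move=> _ [n _ <-]]. Qed.

Let D (x y : set_type P) := mdist (set_val x) (set_val y) + q (set_val x)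
  (set_val y).

Let q_ge0 x y : 0 <= q x y.
Proof. exact: le_trans (q_ub x y 0%N). Qed.

Let D_ge x y : mdist (set_val x) (set_val y) <= D x y.
Proof. by rewrite lerDl. Qed.

Let D_metric : is_metric D.
Proof.
split.
- move=> x y; split=> [Dxy|->]; last first.
    apply/eqP; rewrite /D mdistxx add0r eq_le q_ge0 andbT.
    by apply: q_le => n; rewrite subrr normr0.
  apply: val_inj; apply: mdist_positivity; apply/eqP.
  by rewrite eq_le mdist_ge0 andbT -Dxy D_ge.
- move=> x y; rewrite /D metric_sym; congr (_ + sup _).
  by apply: eq_imagel => n _; rewrite distrC.
- move=> x y z; rewrite /D addrACA lerD ?metric_triangle//.
  apply: q_le => n; apply: le_trans (lerD (q_ub _ _ n) (q_ub _ _ n)).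
  by rewrite (le_trans _ (ler_normD _ _))// addrA subrK.
Qed.

(* For n <= N the functions F n are controlled by continuity, and for n >= N
   both F n x and F n y are small by monotonicity. *)
Let near_D (x : T) e : P x -> 0 < e ->
  \forall y \near x, mdist x y + q x y < e.
Proof.
move=> /PE /cvgrPdist_lt Fx e0; have e4 : 0 < e / 4 by rewrite divr_gt0.
have [N _ /(_ N (leqnn N))/=] := Fx _ e4;
  rewrite sub0r normrN ger0_norm// => FN.
have nF n : \forall y \near x, `|F n x - F n y| < e / 4.
  by have /cvgrPdist_lt := @F_continuous n x; apply.
have nB : \forall y \near x, mdist x y < e / 4.
  by apply: (@filterS _ (nbhs x) _ _ _ _ (nbhsx_ballx x _ e4)) => y;
    rewrite ballEmdist.
apply: filterS2 nB (near_forall_leq N nF) => y xy Fy.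
have : q x y <= e / 2; last by lra.
apply: q_le => n; have [nN|/ltnW Nn] := leqP n N.
  by have := Fy n nN; lra.
have := Fy N (leqnn N); have := F_noninc x Nn; have := F_noninc y Nn.
by have := F_ge0 n x; have := F_ge0 n y; rewrite ler_norml ltr_norml; lra.
Qed.

Let D_metrizes : metrizes D.
Proof.
move=> x; apply/seteqP; split=> A.
  rewrite (metrizes_set_type x) => -[e /= e0 eA]; exists e => //= y Dxy.
  by apply: eA => /=; exact: le_lt_trans (D_ge x y) Dxy.
move=> [e /= e0 eA]; rewrite (metrizes_set_type x).
have := near_D (set_mem (valP x)) e0.
rewrite metricType_numDomainType.nbhs_mdistP => -[r /= r0 rP].
by exists r => //= y xy; apply: eA; exact: rP.
Qed.

(** A [D]-Cauchy sequence is Cauchy in [T] and has a limit [l] there. Passing to the limit in the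
    [q] part gives [F n l <= F n (u N) + e / 2] for all [n] at once, so [F n l] tends to 0 and [l]
    stays in [P]. *)
Lemma decreasing_limit_completely_metrizable :
  metric_complete (T := T) (@mdist R T) -> completely_metrizable R (set_type P).
Proof.
move=> Tc; exists D; split => // u uC.
have [e e0|l lP] := Tc (set_val \o u).
  have [N NP] := uC e e0; exists N => m n Nm Nn.
  exact: le_lt_trans (D_ge _ _) (NP m n Nm Nn).
have Fl n : F n (set_val (u m)) @[m --> \oo] --> F n l.
  exact: (cvg_comp _ _ lP (@F_continuous n l)).
have Pl : P l.
  apply/PE/cvgrPdist_lt => e e0; have e2 : 0 < e / 2 by rewrite divr_gt0.
  have [N NP] := uC _ e2.
  have /PE/cvgrPdist_lt/(_ _ e2) := set_mem (valP (u N)).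
  apply: filterS => n; rewrite !sub0r !normrN !ger0_norm// => uNn.
  have : F n l <= F n (set_val (u N)) + e / 2; last by rewrite /set_val/=; lra.
  rewrite -(cvg_lim (@norm_hausdorff _ R) (Fl n)); apply: limr_le.
    exact: cvgP (Fl n).
  exists N => // m /= Nm; have := NP _ _ Nm (leqnn N).
  have := q_ub (set_val (u m)) (set_val (u N)) n; rewrite /D ler_norml.
  by have := mdist_ge0 (set_val (u m)) (set_val (u N)); lra.
exists (exist _ l (mem_set Pl)).
(* Convergence is tested with [mdist], which metrizes the same topology on [P] as [D]. *)
apply/(metrizes_cvgP _ _ (@metrizes_set_type P)) => e e0.
by move/(metrizes_cvgP _ _ (@metrizes_mdist R T)): lP; apply.
Qed.

End subspaces.

(** * The positive cone of L^1 *)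

Section L1_positive.
Context d (T : measurableType d) (R : realType).
Variable mu : {measure set T -> \bar R}.
Local Notation L1 := (LspaceType1 mu).
Implicit Types g h : L1.

Lemma mdist_L1_Rintegral g h :
  mdist g h = \int[mu]_x `|L1fun g x - L1fun h x|.
Proof. by apply: EFin_inj; rewrite mdist_L1E /Rintegral -mdist_L1E. Qed.

Definition L1pos : set L1 := [set g | {ae mu, forall x, 0 < L1fun g x}].

Variable w : L1.
Hypothesis w_pos : L1pos w.

(** The two positive parts keep [k] between 0 and [|w|] whatever the sign of [g], so [|w|] dominates
    all these functions. *)
Let k n g x : R := Num.max 0 (L1fun w x - n%:R * Num.max 0 (L1fun g x)).

Let k_ge0 n g x : 0 <= k n g x.
Proof. by rewrite le_max lexx. Qed.

Let k_le n g x : k n g x <= `|L1fun w x|.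
Proof.
rewrite ge_max normr_ge0/=; apply: le_trans (ler_norm _).
by rewrite gerBl mulr_ge0// le_max lexx.
Qed.

Let k_measurable n g : measurable_fun setT (k n g).
Proof.
apply: measurable_maxr => //; apply: measurable_funB;
  first exact: L1fun_measurable.
apply: measurable_funM => //; apply: measurable_maxr => //.
exact: L1fun_measurable.
Qed.

Let k_integrable n g : mu.-integrable setT (EFin \o k n g).
Proof.
apply: le_integrable (L1fun_integrable w) => //; first exact/measurable_EFinP.
by move=> x _ /=; rewrite lee_fin ger0_norm// k_le.
Qed.

(* L1defect n decreases to the integral of w over the set where g <= 0. *)
Definition L1defect (n : nat) (g : L1) : R := \int[mu]_x k n g x.

(** The positive part is 1-Lipschitz; the factor [n] comes from the coefficient between its two
    uses. *)
Lemma L1defect_lip n g h : `|L1defect n g - L1defect n h| <= n%:R * mdist g h.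
Proof.
rewrite mdist_L1_Rintegral.
have Igh : mu.-integrable setT (EFin \o (fun x => L1fun g x - L1fun h x)).
  exact: (integrableB measurableT (L1fun_integrable g) (L1fun_integrable h)).
have In : mu.-integrable setT (EFin \o (fun x => `|L1fun g x - L1fun h x|)).
  exact: integrable_norm.
have Ik : mu.-integrable setT (EFin \o (fun x => k n g x - k n h x)).
  exact: (integrableB measurableT (k_integrable n g) (k_integrable n h)).
rewrite -RintegralZl// -RintegralB//.
apply: le_trans (le_normr_Rintegral measurableT Ik) _.
apply: le_Rintegral => //; first exact: integrable_norm.
  exact: (integrableZl measurableT n%:R In).
have max_lip (a b : R) : `|Num.max 0 a - Num.max 0 b| <= `|a - b|.
  have := ler_norm (a - b); have := ler_norm (b - a); rewrite (distrC b a).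
  by rewrite ler_norml /Num.max; case: ltP => ?; case: ltP => ?; lra.
move=> x _; rewrite /k; apply: le_trans (max_lip _ _) _.
rewrite opprB addrC addrA subrK -mulrBr normrM normr_nat ler_wpM2l//.
by rewrite distrC.
Qed.

Lemma L1defect_continuous n : continuous (L1defect n).
Proof.
move=> g; apply/(@cvgrPdist_lt _ _ _ (nbhs g) _) => e e0.
(* The successor avoids a division by 0 at [n = 0]. *)
have r0 : 0 < e / n.+1%:R by rewrite divr_gt0.
apply: (@filterS _ (nbhs g) _ _ _ _ (nbhsx_ballx g _ r0)) => h.
rewrite ballEmdist/= ltr_pdivlMr// => gh;
  apply: le_lt_trans (L1defect_lip n g h) _.
by apply: le_lt_trans gh; rewrite mulrC ler_wpM2l ?mdist_ge0// ler_nat.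
Qed.

Lemma L1defect_ge0 n g : 0 <= L1defect n g.
Proof. by apply: Rintegral_ge0 => x _. Qed.

Lemma L1defect_noninc g : {homo L1defect^~ g : m n / (m <= n)%N >-> n <= m}.
Proof.
move=> m n mn; apply: le_Rintegral => // x _; rewrite /k.
rewrite ge_max le_max lexx/= le_max; apply/orP; right.
by rewrite lerB// ler_wpM2r// ?le_max ?lexx// ler_nat.
Qed.

(** Where [g > 0], the integrand vanishes once [n] exceeds [|w| / g], and dominated convergence
    applies. Conversely [j], the positive part of [w] cut off to [g <= 0], lies below every [k n g];
    its integral is thus 0, and since [w > 0] a.e. the set [N] is null. *)
Lemma L1posP g : L1pos g <-> L1defect n g @[n --> \oo] --> 0.
Proof.
split=> [g0|Fg].
  have [] := @dominated_convergence _ _ _ mu setT measurableT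
    (fun n x => (k n g x)%:E) (cst 0) (fun x => `|(L1fun w x)%:E|)%E.
  - by move=> n; exact/measurable_EFinP.
  - exact: measurable_cst.
  - apply: filterS g0 => x gx _; apply: cvg_near_cst.
    exists (Num.truncn (`|L1fun w x| / L1fun g x)).+1 => // n /= nx.
    apply/eqP; rewrite eqe eq_le k_ge0 andbT ge_max lexx/= subr_le0.
    apply: (le_trans (ler_norm _)); rewrite /Num.max gx -ler_pdivrMr//.
    by apply: le_trans (ltW (truncnS_gt _)) _; rewrite ler_nat.
  - by apply: integrable_abse; exact: L1fun_integrable.
  - by apply: aeW => x n _; rewrite gee0_abs ?lee_fin//; exact: k_le.
  by move=> _ _; rewrite integral0 => /fine_cvgP[_].
pose N := L1fun g @^-1` `]-oo, 0].
have mN : measurable N by rewrite -[N]setTI; exact: L1fun_measurable.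
pose j x : R := Num.max 0 (L1fun w x) * \1_N x.
have jk n x : j x <= k n g x.
  rewrite /j indicE; have [|] := boolP (x \in N).
    rewrite inE /N/= in_itv/= => gx; rewrite mulr1 /k.
    by rewrite (max_l gx) mulr0 subr0.
  by rewrite mulr0.
have j0 x : 0 <= j x by rewrite mulr_ge0// le_max lexx.
have mj : measurable_fun setT (EFin \o j).
  apply/measurable_EFinP; apply: measurable_funM => //.
  by apply: measurable_maxr => //; exact: L1fun_measurable.
have Ij : mu.-integrable setT (EFin \o j).
  apply: le_integrable (k_integrable 0 g) => // x _ /=.
  by rewrite lee_fin !ger0_norm.
have Rj0 : \int[mu]_x j x = 0.
  apply/eqP; rewrite eq_le Rintegral_ge0// andbT.
  rewrite -(cvg_lim (@norm_hausdorff _ R) Fg); apply: limr_ge.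
    exact: cvgP Fg.
  by apply: nearW => n; apply: le_Rintegral.
have Ij0 : (\int[mu]_x (j x)%:E = 0)%E.
  by rewrite -(fineK (integrable_fin_num measurableT Ij)); congr EFin.
have : (\int[mu]_x `|(j x)%:E| = 0)%E.
  by rewrite -[RHS]Ij0; apply: eq_integral => x _; rewrite gee0_abs ?lee_fin.
move=> /(ae_eq_integral_abs mu measurableT mj) jae.
apply: filterS2 w_pos jae => x wx /(_ Logic.I)[]; rewrite /j indicE.
have [|xN _] := boolP (x \in N).
  by rewrite mulr1 /Num.max wx => _ w0; move: wx; rewrite w0 ltxx.
by rewrite ltNge; apply: contra xN => gx; rewrite inE /N/= in_itv.
Qed.

End L1_positive.

Lemma L1pos_completely_metrizable d (T : measurableType d) (R : realType)
  (mu : {measure set T -> \bar R}) :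
    completely_metrizable R (set_type (@L1pos _ _ _ mu)).
Proof.
have [[w]|T0] := pselect (inhabited (set_type (@L1pos _ _ _ mu))).
  have wP := set_mem (valP w).
  apply: (decreasing_limit_completely_metrizable (F := L1defect (set_val w))).
  - exact: L1defect_continuous.
  - exact: L1defect_ge0.
  - exact: L1defect_noninc.
  - by move=> x; exact: L1posP.
  - exact: L1_complete.
(* Without a weight [w] the cone is empty, as happens when [mu] is not sigma-finite, and any metric
   will do. *)
have noT (x : set_type (@L1pos _ _ _ mu)) : False by exact: T0 (inhabits x).
exists (fun _ _ => 0); split; first by split=> x; case: (noT x).
  by move=> x; case: (noT x).
by move=> u; case: (noT (u 0%N)).
Qed.

(** * The action on L^1_{++} *)

Section positive_half_line.
Variable R : realType.
Local Notation lambda := (@lebesgue_measure R).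
Local Notation lambda_pos := (lambda_pos R).
Local Notation L1 := (LspaceType1 lambda_pos).

Lemma integral_lambda_pos (A : set R) (f : R -> \bar R) : A `<=` posreals R ->
  (\int[lambda_pos]_(x in A) f x = \int[lambda]_(x in A) f x)%E.
Proof.
move=> Apos; apply: eq_measure_integral => B mB BA.
rewrite /Defs.lambda_pos/= /mrestr setIidl//.
exact: subset_trans BA Apos.
Qed.

Lemma ae_lambda_pos_gt0 : {ae lambda_pos, forall x, 0 < x}.
Proof.
exists (~` posreals R); split => //.
- by apply: measurableC; exact: measurable_posreals.
- by rewrite /Defs.lambda_pos/= /mrestr setICl measure0.
Qed.

(** * Separability of L^1 of the half-line *)

Let D (N : nat) : set R := `]0, N%:R]%classic.

Let mD N : measurable (D N : set (measurableTypeR R)).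
Proof. exact: measurable_itv. Qed.

(** The interval is open at 0 for this inclusion, under which integrals for [lambda_pos] and
    [lambda] agree. *)
Let Dpos N : D N `<=` posreals R.
Proof. by move=> x; rewrite /D/= in_itv/= => /andP[]. Qed.

Let lambda_D N : lambda (D N) = N%:R%:E.
Proof.
rewrite lebesgue_measure_itv/= lte_fin; case: ltP; rewrite ?sube0// => N0.
by congr EFin; apply/eqP; rewrite eq_le N0 ler0n.
Qed.

(** Dominated convergence: each [x > 0] lies in [D n] as soon as [n > x], and [lambda_pos]-almost
    every point is positive. *)
Lemma L1_tail (g : L1) (e : R) : 0 < e ->
  exists N : nat, (\int[lambda_pos]_(x in ~` D N) `|(L1fun g x)%:E| < e%:E)%E.
Proof.
move=> e0; have mg := L1fun_measurable g.
have mf n : measurable_fun setT (fun x => `|L1fun g x| * \1_(~` D n) x).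
  apply: measurable_funM; first exact: measurableT_comp.
  by apply: measurable_indic; apply: measurableC; exact: mD.
have [] := @dominated_convergence _ _ _ lambda_pos setT measurableT
  (fun n x => (`|L1fun g x| * \1_(~` D n) x)%:E) (cst 0)
  (fun x => `|(L1fun g x)%:E|)%E.
- by move=> n; apply/measurable_EFinP; exact: mf.
- exact: measurable_cst.
- have FF : Filter (nbhs (almost_everywhere lambda_pos)).
  exact: (@ae_filter_ringOfSetsType _ (measurableTypeR R) R lambda_pos).
  apply: filterS ae_lambda_pos_gt0 => x x0 _; apply: cvg_near_cst.
  exists (Num.truncn x).+1 => // n /= xn.
  have xD : D n x.
    rewrite /D/= in_itv/= x0/=; apply: ltW.
    by apply: lt_le_trans (truncnS_gt x) _; rewrite ler_nat.
  by rewrite indicE memNset ?mulr0// => /(_ xD).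
- by apply: integrable_abse; exact: L1fun_integrable.
- apply: aeW => x n _; rewrite abse_EFin lee_fin normrM normr_id.
  by apply: ler_piMr => //; rewrite indicE normr_nat lern1; case: (_ \in _).
have fE n : (\int[lambda_pos]_x (`|L1fun g x| * \1_(~` D n) x)%:E =
    \int[lambda_pos]_(x in ~` D n) `|(L1fun g x)%:E|)%E.
  rewrite [RHS]integral_mkcond; apply: eq_integral => x _.
  by rewrite patchE indicE; case: ifP => _; rewrite ?mulr1 ?mulr0.
move=> _ _; rewrite integral0 =>
  /fine_cvgP[[m _ mfin]] /cvgrPdist_lt/(_ _ e0)[n _ nP].
(* The index [m + n] is past both thresholds: finiteness of the integral and its smallness. *)
have /= := mfin _ (leq_addr n m); have /= := nP _ (leq_addl m n).
rewrite sub0r normrN fE => mn_lt mn_fin; exists (m + n)%N.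
by rewrite -(fineK mn_fin) lte_fin; exact: le_lt_trans (ler_norm _) mn_lt.
Qed.

Let hD (h : R -> R) N x : R := h x * \1_(D N) x.

Let integrable_hD h N : continuous h -> lambda.-integrable (D N) (EFin \o h) ->
  lambda_pos.-integrable setT (EFin \o hD h N).
Proof.
move=> ch /integrableP[_ Ih].
have mh : measurable_fun setT (hD h N).
  apply: measurable_funM; first exact: continuous_measurable_fun.
  by apply: measurable_indic; exact: mD.
apply/integrableP; split; first exact/measurable_EFinP.
rewrite (_ : (\int[_]_x _)%E = (\int[lambda_pos]_(x in D N) `|(h x)%:E|)%E).
  by rewrite integral_lambda_pos.
rewrite [RHS]integral_mkcond; apply: eq_integral => x _.
by rewrite patchE /hD /= indicE; case: ifP => _; rewrite ?mulr1 ?mulr0 ?normr0.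
Qed.

(** Half of [e] pays for the tail of [g] outside [D N], the other half for a continuous
    approximation on [D N], which has finite Lebesgue measure. *)
Lemma L1_approx (g : L1) (e : R) : 0 < e ->
  exists (N : nat) (h : R -> R) (Ih :
    lambda_pos.-integrable setT (EFin \o hD h N)),
    continuous h /\ mdist g (L1class Ih) < e.
Proof.
move=> e0; have e2 : 0 < e / 2 by rewrite divr_gt0.
have [N NP] := L1_tail g e2.
have Ig : lambda.-integrable (D N) (EFin \o L1fun g).
  have /integrableP[mg Ig] := L1fun_integrable g.
  apply/integrableP; split; first exact: measurable_funTS.
  rewrite -integral_lambda_pos//; apply: le_lt_trans Ig.
  by apply: ge0_subset_integral => //; exact: measurableT_comp.
have [|h_ [ch Ih]] := approximation_continuous_integrable (mD N) _ Ig.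
  by apply: (@eq_ind_r _ _ (fun t => (t < +oo)%E) _ _ (lambda_D N));
    exact: ltry.
move=> /fine_cvgP[[m _ mfin]] /cvgrPdist_lt/(_ _ e2)[n _ nP].
pose h := h_ (m + n)%N.
have hP : (\int[lambda]_(x in D N) `|(L1fun g x - h x)%:E| < (e / 2)%:E)%E.
  have /= := mfin _ (leq_addr n m); have /= := nP _ (leq_addl m n).
  rewrite sub0r normrN => mn_lt mn_fin.
  by rewrite -(fineK mn_fin) lte_fin; exact: le_lt_trans (ler_norm _) mn_lt.
exists N, h, (integrable_hD (ch _) (Ih _)); split; first exact: ch.
rewrite -lte_fin mdist_L1class -(setUv (D N)) ge0_integral_setU//=.
- rewrite (splitr e) EFinD; apply: lteD.
    rewrite integral_lambda_pos//; apply: le_lt_trans hP.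
    rewrite le_eqVlt; apply/orP; left; apply/eqP/eq_integral => x xD.
    by rewrite /hD indicE xD mulr1.
  apply: le_lt_trans NP; rewrite le_eqVlt; apply/orP; left;
    apply/eqP/eq_integral => x.
  by rewrite inE => xD; rewrite /hD indicE memNset// mulr0 subr0.
- by apply: measurableC; exact: mD.
- apply: measurable_funTS; apply/measurable_EFinP;
  apply: measurableT_comp => //.
  apply: measurable_funB; first exact: L1fun_measurable.
  apply/measurable_EFinP; apply: measurable_int (integrable_hD (ch (m + n)%N)
    (Ih _)).
- by apply/disj_setPCl.
Qed.

(** Precision [e / 4 / (n + 1)] on [[0, n]] integrates to at most [e / 4] over a set of measure [n].
    Adding the two approximation errors gives less than [3 e / 4]. *)
Lemma L1_labelled (e : R) : 0 < e -> countably_labelled (@mdist R L1) e.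
Proof.
move=> e0; have e4 : 0 < e / 4 by rewrite divr_gt0.
have /choice[N /choice[h hP]] g := L1_approx g e4.
have /choice[c cP] (n : nat) :=
  @segment_continuous_labelled R n (e / 4 / n.+1%:R)
  ltac:(by rewrite divr_gt0).
apply: (@labelled _ _ _ _ _ (fun g => (N g, c (N g) (h g)))) => f g fg.
have Nfg : N f = N g := congr1 fst fg.
have cfg : c (N f) (h f) = c (N g) (h g) := congr1 snd fg.
have [If [cf df]] := hP f; have [Ig [cg dg]] := hP g.
have hfg : mdist (L1class If) (L1class Ig) <= e / 4.
  rewrite -lee_fin mdist_L1class2.
  apply: (@le_trans _ _ (\int[lambda_pos]_(x in D (N f))
    (e / 4 / (N f).+1%:R)%:E)%E).
    rewrite [leRHS]integral_mkcond; apply: ge0_le_integral => //.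
    - have mh k : lambda_pos.-integrable setT (EFin \o k) ->
      measurable_fun setT k.
        by move=> /(measurable_int lambda_pos)/measurable_EFinP.
      apply: measurableT_comp => //; apply/measurable_EFinP.
      by apply: measurable_funB; exact: mh.
    - by apply/(measurable_restrictT _ (mD _)).
    - move=> x _; rewrite patchE /hD -Nfg !indicE; case: ifP => xD.
        rewrite !mulr1 lee_fin; apply: ltW; apply: cP => //;
          first by rewrite Nfg -cfg Nfg.
        by move: xD; rewrite inE /D/= !in_itv/= => /andP[/ltW-> ->].
      by rewrite !mulr0 subrr abse0.
  rewrite integral_lambda_pos// integral_cst//.
  rewrite [X in (_ * X)%E](_ : _ = (N f)%:R%:E); last exact: lambda_D.
  rewrite -EFinM lee_fin.
  have n0 : 0 < (N f).+1%:R :> R by rewrite ltr0n.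
  suff : e / 4 / (N f).+1%:R * (N f)%:R <= e / 4 by [].
  by rewrite mulrAC ler_pdivrMr// ler_wpM2l ?(ltW e4)// ler_nat.
have := metric_triangle f (L1class If) g.
have := metric_triangle (L1class If) (L1class Ig) g.
by rewrite (metric_sym g) in dg; lra.
Qed.

(** Separability is obtained with the L^1-distance, complete metrizability with the modified one;
    both metrize the same topology. *)
Lemma L1pp_polish : polish_space R (L1pp R).
Proof.
split; last exact: L1pos_completely_metrizable.
apply: separable_labelled (@metrizes_set_type R L1 (@L1pp_set R)) _ => e e0.
exact/countably_labelled_sub/L1_labelled.
Qed.

(** * Algebraic laws and joint continuity of the action *)

Lemma L1pp_group_action : group_action (@L1pp_act R).
Proof.
have FF : Filter (nbhs (almost_everywhere lambda_pos)).
  exact: (@ae_filter_ringOfSetsType _ (measurableTypeR R) R lambda_pos).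
split=> [x|f g x]; apply/val_inj/L1_eq.
  apply: filterS (L1mulE (1%g : Fspace R) (set_val x)) => t /(_ Logic.I) -> _.
  have [t0|t0] := leP t 0; first by rewrite valL_out// mul1r.
  by have [y ->] := posrealsE t0; rewrite valL_pos mul1r.
apply: filterS3 (L1mulE (f * g)%g (set_val x)) (L1mulE g (set_val x))
  (L1mulE f (set_val (L1pp_act g x))).
move=> t /(_ Logic.I) fgxE /(_ Logic.I) gxE /(_ Logic.I) fxE _.
rewrite fgxE fxE gxE mulrA; congr (_ * _).
have [t0|t0] := leP t 0; first by rewrite !valL_out// mul1r.
by have [y ->] := posrealsE t0; rewrite !valL_pos.
Qed.

(** Writing [u'] as [u - (u - u')] in [a (u - u') + (a - a') u'] leaves only the size of [f], the
    norm of [g] and the two distances in the bound, as continuity at [(f, g)] requires. *)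
Lemma mdist_L1mul (f f' : Fspace R) (g g' : L1) (M : R) :
  (forall x, `|'valL_1 f x| <= M) ->
  mdist (L1mul f g) (L1mul f' g') <=
    (M + rho f f') * mdist g g' + rho f f' * \int[lambda_pos]_x `|L1fun g x|.
Proof.
move=> fM; have r0 : 0 <= rho f f' by rewrite -Fspace_mdistE mdist_ge0.
have Igg : lambda_pos.-integrable setT (EFin \o (fun x =>
  L1fun g x - L1fun g' x)).
  exact: (integrableB measurableT (L1fun_integrable g) (L1fun_integrable g')).
have Iagg := integrable_norm Igg.
have Iag := integrable_norm (L1fun_integrable g).
have I1 := integrableZl measurableT (M + rho f f') Iagg.
have I2 := integrableZl measurableT (rho f f') Iag.
have I3 := integrableD measurableT I1 I2.
have I0 := integrableB measurableT (integrable_Fmul f g)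
  (integrable_Fmul f' g').
rewrite mdist_L1class2_Rintegral mdist_L1_Rintegral -!RintegralZl//
  -RintegralD//.
apply: le_Rintegral => //; first exact: integrable_norm I0.
move=> x _; have ff' : `|'valL_1 f x - 'valL_1 f' x| <= rho f f'.
  have [x0|x0] := leP x 0; first by rewrite !valL_out// subrr normr0.
  have [y ->] := posrealsE x0; rewrite !valL_pos.
  exact: le_trans (ler_dpos _ _) (rho_ub f f' y).
move: (fM x) ff' => {fM}; move: ('valL_1 f x) ('valL_1 f' x) => a a' aM aa'.
move: (L1fun g x) (L1fun g' x) => u u'.
have -> : a * u - a' * u' = a * (u - u') + (a - a') * (u - (u - u')) by ring.
apply: le_trans (ler_normD _ _) _; rewrite !normrM mulrDl -addrA lerD//.
  exact: ler_wpM2r.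
rewrite -mulrDr; apply: ler_pM => //.
by rewrite (addrC _ `|u|) ler_normB.
Qed.

Lemma L1pp_act_continuous : continuous (fun p :
  Fspace R * L1pp R => L1pp_act p.1 p.2).
Proof.
move=> [f g].
apply/(@metrizes_cvgP _ _ _ _ (nbhs (f,
  g)) _ _ _ (@metrizes_set_type R L1 (@L1pp_set R))).
move=> e e0 /=; have [M fM] := valL_bounded f.
have M0 : 0 <= M by exact: le_trans (fM 0).
pose K := \int[lambda_pos]_x `|L1fun (set_val g) x|.
have K0 : 0 <= K by apply: Rintegral_ge0.
have S0 : 0 < M + K + 2 by lra.
(* With [r <= 1] the bound [(M + r) r + r K] is at most [(M + K + 1) r], strictly less than [e]. *)
pose r := Num.min 1 (e / (M + K + 2)).
have r0 : 0 < r by rewrite lt_min ltr01 divr_gt0.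
have r1 : r <= 1 by rewrite ge_min lexx.
have re : r * (M + K + 2) <= e by rewrite -ler_pdivlMr// ge_min lexx orbT.
exists (ball f r, [set g' : L1pp R | mdist (set_val g) (set_val g') < r]).
  split; first exact: nbhsx_ballx.
  by rewrite /= (@metrizes_set_type R L1 (@L1pp_set R) g); exists r.
move=> [f' g'] /= []; rewrite ballEmdist/= Fspace_mdistE => ff' gg'.
have rho0 : 0 <= rho f f' by rewrite -Fspace_mdistE mdist_ge0.
apply: le_lt_trans (mdist_L1mul f' (set_val g) (set_val g') fM) _.
have d0 := mdist_ge0 (set_val g) (set_val g').
rewrite -/K; apply: (@le_lt_trans _ _ ((M + r) * r + r * K)).
  apply: lerD; last by rewrite ler_wpM2r// ltW.
  by apply: ler_pM => //; [exact: addr_ge0|rewrite lerD2l ltW|exact: ltW].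
by nra.
Qed.

End positive_half_line.

Theorem theorem1p9 (R : realType) :
  ((forall f g : Fspace R, (f * g)%g = (g * f)%g) /\
   polish_group R (Fspace R)) /\
  continuous_polish_group_action R (@L1pp_act R).
Proof.
split.
  split; last exact: Fspace_polish_group.
  by move=> f g; apply: Fspace_eq => x; rewrite !Fspace_mulE mulrC.
split.
- exact: Fspace_polish_group.
- exact: L1pp_polish.
- exact: L1pp_group_action.
- exact: L1pp_act_continuous.
Qed.
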